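(* For every $f:\{0,1\}^n\to\{0,1\}$ computable by a width-$d$ read-once branching program of length $n$, there is an integer $0\le k\le n$ and a function $g:\{0,1\}^{n-k}\to\{0,1\}$ computable by a width-$d$ read-once branching program with sudden death of length $n-k$, such that $\{0^k\circ y: g(y)=1\}\subseteq f^{-1}(1)$ and $\mathbb{E}[g]\ge\mathbb{E}[f]^2/(2n)$.
   Context: A read-once branching program (ROBP) of width $d$ and length $n$ has vertex set partitioned into layers $V_0\cup\cdots\cup V_n$ with $V_0=\{(0,0)\}$ (start state), $V_t=\{(t,i)\}_{i\in[d]}$ for $1\le t\le n-1$, $V_n=\{(n,1),(n,d)\}$ ($(n,1)$ accepts, $(n,d)$ rejects). Each vertex of $V_t$ ($t<n$) has two out-edges labeled $0$ and $1$ into $V_{t+1}$. On input $x\in\{0,1\}^n$, start at $(0,0)$ and from layer $t$ follow the edge labeled $x_{t+1}$; $x$ is accepted iff the path ends at $(n,1)$. A width-$d$ ROBP with sudden death is one in which both out-edges of $(t,d)$ go to $(t+1,d)$ for all $t=1,\ldots,n-1$ (so the bottom-level states are all rejecting). $\mathbb{E}$ is under the uniform distribution. *)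

(* Defs.v *)
From mathcomp Require Import all_boot all_order all_algebra.

Set Implicit Arguments.
Unset Strict Implicit.
Unset Printing Implicit Defensive.

Import Order.TTheory GRing.Theory Num.Theory.

(** A vertex (t, i) of layer t is represented by its label i; labels are
    numbered from 1 to d, and 0 is used only for the start state.
    For n = 0 the single layer is {0}, so that a program of length 0, whose
    path never reaches an accepting vertex, rejects its (empty) input. *)
Definition layer (d n t : nat) : pred nat :=
  fun i => if t == 0 then i == 0
           else if t == n then (i == 1) || (i == d)
           else 1 <= i <= d.

(** [edge B t i b] is the label, in layer t+1, of the head of the b-labeled
    edge out of (t, i); only its values at t < n and i in layer t matter. *)
Record robp (d n : nat) : Type := Robp {
  edge : nat -> nat -> bool -> nat;
  edge_layer : forall t i b,
    t < n -> layer d n t i -> layer d n t.+1 (edge t i b)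
}.

Fixpoint state (d n : nat) (B : robp d n) (x : n.-tuple bool) (t : nat) : nat :=
  if t is t'.+1 then edge B t' (state B x t') (nth false x t') else 0.

Definition accepts (d n : nat) (B : robp d n) (x : n.-tuple bool) : bool :=
  state B x n == 1.

Definition computes (d n : nat) (B : robp d n) (f : n.-tuple bool -> bool) : Prop :=
  forall x, accepts B x = f x.

Definition sudden_death (d n : nat) (B : robp d n) : Prop :=
  forall t b, 1 <= t < n -> edge B t d b = d.

Definition robp_computable (d n : nat) (f : n.-tuple bool -> bool) : Prop :=
  exists B : robp d n, computes B f.

Definition sudden_death_robp_computable (d n : nat)
    (f : n.-tuple bool -> bool) : Prop :=
  exists2 B : robp d n, sudden_death B & computes B f.

Definition expectation (n : nat) (f : n.-tuple bool -> bool) : rat :=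
  ((\sum_(x : n.-tuple bool) (f x)%:R) / #|{: n.-tuple bool}|%:R)%R.

(** The string 0^k y, of length k + (n - k), as an n-tuple. *)
Definition zeros_cat (n k : nat) (le_kn : k <= n) (y : (n - k).-tuple bool) :
    n.-tuple bool :=
  tcast (subnKC le_kn) [tuple of nseq k false ++ y].

(* Main.v *)
Require Import Defs.
From mathcomp Require Import all_boot all_order all_algebra.
From mathcomp Require Import zify lra.

(** Let a = E[f], and let m_t be the least acceptance probability of a vertex
    in layer t.  Since m_0 = a, there is a last t < n with
    m_t >= (n - t) a / n; call it k.  Start at the vertex reached by 0^k, which
    accepts with probability at least m_k, and in each later layer turn a vertex
    of least acceptance probability into the dead state (by exchanging its label
    with d).  A path dies at most once, and then at a vertex whose acceptance
    probability was at most (n - k - 1) a / n, so that the new program still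
    accepts with probability at least a / n >= a ^ 2 / (2 n). *)

Import Order.TTheory GRing.Theory Num.Theory.

(** * Runs and acceptance probabilities from an arbitrary vertex *)

Fixpoint run (e : nat -> nat -> bool -> nat) (t i : nat) (s : seq bool) : nat :=
  if s is b :: s' then run e t.+1 (e t i b) s' else i.

(** Like [run], this takes a bare edge function, so that it applies to [kill_edge] with no layer
    condition; [r] counts the bits still to be read. *)
Fixpoint accept_prob (e : nat -> nat -> bool -> nat) (t r i : nat) : rat :=
  if r is r'.+1 then
    ((accept_prob e t.+1 r' (e t i false) +
      accept_prob e t.+1 r' (e t i true)) / 2)%R
  else ((i == 1) %:R)%R.

Lemma run_cat e t i s1 s2 :
  run e t i (s1 ++ s2) = run e (t + size s1) (run e t i s1) s2.
Proof.
by elim: s1 t i => [|b s1 IH] t i /=; rewrite ?addn0 // IH addSnnS.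
Qed.

Lemma run_layer d n (B : robp d n) t i s : t + size s <= n ->
  layer d n t i -> layer d n (t + size s) (run (edge B) t i s).
Proof.
elim: s t i => [|b s IH] t i /=; first by rewrite addn0.
rewrite -addSnnS => le_n ti; apply: IH => //.
by apply: edge_layer => //; lia.
Qed.

Lemma state_run d n (B : robp d n) (x : n.-tuple bool) t : t <= n ->
  state B x t = run (edge B) 0 0 (take t x).
Proof.
elim: t => [|t IH] lt_tn; first by rewrite take0.
rewrite (take_nth false) ?size_tuple // -cats1 run_cat /= IH 1?ltnW //.
by rewrite size_takel // size_tuple ltnW.
Qed.

Lemma accepts_run d n (B : robp d n) (x : n.-tuple bool) :
  accepts B x = (run (edge B) 0 0 x == 1).
Proof. by rewrite /accepts state_run // take_oversize ?size_tuple. Qed.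

Lemma sum_tuple_cons (V : nmodType) r (F : r.+1.-tuple bool -> V) :
  (\sum_x F x = \sum_(x : r.-tuple bool) F [tuple of false :: x] +
                \sum_(x : r.-tuple bool) F [tuple of true :: x])%R.
Proof.
rewrite (reindex (fun p : bool * r.-tuple bool => [tuple of p.1 :: p.2])) /=.
  rewrite -(pair_big xpredT xpredT (fun b (x : r.-tuple bool) => F [tuple of b :: x])) /=.
  by rewrite big_bool addrC.
exists (fun x => (thead x, [tuple of behead x])) => [[b x] _|x _] /=.
  by congr pair; apply: val_inj.
by rewrite -tuple_eta.
Qed.

Lemma expectation_run e t r i :
  expectation (fun x : r.-tuple bool => run e t i x == 1) = accept_prob e t r i.
Proof.
rewrite /expectation card_tuple card_bool.
elim: r t i => [|r IH] t i /=.
  by rewrite (big_pred1 [tuple]) ?divr1 // => x; apply/esym/eqP/tuple0.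
by rewrite sum_tuple_cons -!IH /= expnS natrM invfM [(2%:R^-1 * _)%R]mulrC mulrA mulrDl.
Qed.

Lemma eq_expectation n (f g : n.-tuple bool -> bool) :
  f =1 g -> expectation f = expectation g.
Proof. by move=> fg; rewrite /expectation; under eq_bigr do rewrite fg. Qed.

Lemma expectation_ge0 n (f : n.-tuple bool -> bool) : (0 <= expectation f)%R.
Proof. by apply: divr_ge0 => //; apply: sumr_ge0 => x _; apply: ler0n. Qed.

Lemma expectation_le1 n (f : n.-tuple bool -> bool) : (expectation f <= 1)%R.
Proof.
rewrite /expectation ler_pdivrMr ?ltr0n ?card_tuple ?card_bool ?expn_gt0 //.
rewrite mul1r -natr_sum ler_nat -[(2 ^ n)%N]muln1.
have -> : (2 ^ n)%N = #|{: n.-tuple bool}| by rewrite card_tuple card_bool.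
by rewrite -sum_nat_const leq_sum // => x _; case: (f x).
Qed.

(** * Least acceptance probabilities and the choice of the starting layer *)

Lemma layer_leq d n t i : 0 < d -> layer d n t i -> i <= d.
Proof. by rewrite /layer; case: eqP => _; [lia|case: eqP => _; lia]. Qed.

(** A sigma type rather than an existential, so that the choice yields a function [v] of the
    layer. *)
Lemma min_accept_vertex d n (e : nat -> nat -> bool -> nat) t :
  0 < d -> {v | layer d n t v &
    forall i, layer d n t i ->
      (accept_prob e t (n - t) v <= accept_prob e t (n - t) i)%R}.
Proof.
(* Read as a number, [t != 0] is 0 in the start layer and 1 in all others, hence a label of every
   layer. *)
move=> d_gt0; have lt_d : (t != 0) < d.+1 by case: (t != 0).
have P0 : layer d n t (Ordinal lt_d).
  by rewrite /layer /=; do 2?case: eqP => //=.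
case: (@arg_minP _ _ _ (Ordinal lt_d) (fun i : 'I_d.+1 => layer d n t i)
  (fun i : 'I_d.+1 => accept_prob e t (n - t) i) P0) => v tv min_v.
exists v => // i ti; have lt_id : i < d.+1 by rewrite ltnS (layer_leq d n t).
exact: (min_v (Ordinal lt_id)).
Qed.

Lemma last_above_line (m : nat -> rat) n (c : rat) : 0 < n ->
  (n%:R * c <= m 0)%R ->
  exists2 k, k < n & ((n - k)%:R * c <= m k)%R /\
    forall t, k < t < n -> (m t < (n - t)%:R * c)%R.
Proof.
move=> n_gt0 m0.
pose P t := (t < n) && ((n - t)%:R * c <= m t)%R.
have exP : exists t, P t by exists 0; rewrite /P n_gt0 subn0.
have ubP t : P t -> t <= n by case/andP=> /ltnW.
case: (ex_maxnP exP ubP) => k /andP[lt_kn mk] max_k.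
exists k => //; split=> // t /andP[lt_kt lt_tn].
rewrite ltNge; apply/negP => mt.
by have := max_k t; rewrite /P lt_tn mt => /(_ isT); rewrite leqNgt lt_kt.
Qed.

(** * The program with a dead state *)

Definition swap_nat (a b i : nat) : nat :=
  if i == a then b else if i == b then a else i.

(** Label [i] of the killing program in layer [t] of the original one stands
    for the vertex [relabel d n v t i]; the last layer is not relabelled. *)
Definition relabel (d n : nat) (v : nat -> nat) (t i : nat) : nat :=
  if t < n then swap_nat (v t) d i else i.

Lemma relabelK d n v t : involutive (relabel d n v t).
Proof.
move=> i; rewrite /relabel /swap_nat; case: (t < n) => //.
have [->|ne_iv] := eqVneq i (v t); first by rewrite eqxx; case: eqP.
have [->|ne_id] := eqVneq i d; first by rewrite eqxx.
by rewrite (negPf ne_iv) (negPf ne_id).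
Qed.

Lemma relabel_layer d n v t i : 0 < t -> layer d n t (v t) -> 0 < d ->
  layer d n t i -> layer d n t (relabel d n v t i).
Proof.
move=> t_gt0 tv d_gt0; rewrite /relabel /swap_nat; case: ifP => // lt_tn.
have td : layer d n t d.
  by rewrite /layer; do 2?case: eqP => //=; lia.
by do 2?case: eqP.
Qed.

(** Layer [s] here is layer [k + s] of the original, and the start state stands for [u]. An edge
    decodes its tail, follows [e] and encodes the head; [relabel], an involution, does both. Only
    [d] is exempt, being absorbing. *)
Definition kill_edge (d n k u : nat) (v : nat -> nat)
    (e : nat -> nat -> bool -> nat) (s i : nat) (b : bool) : nat :=
  if s == 0 then relabel d n v k.+1 (e k u b)
  else if i == d then d
  else relabel d n v (k + s).+1 (e (k + s) (relabel d n v (k + s) i) b).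

(** The start layer is excluded: it has the single label 0, whereas layer [k] of the original may be
    a full one. *)
Lemma layer_shift d n k s : k < n -> 0 < s ->
  layer d (n - k) s =1 layer d n (k + s).
Proof.
move=> lt_kn s_gt0 i; rewrite /layer addn_eq0 !(gtn_eqF s_gt0) andbF.
by have -> : (s == n - k) = (k + s == n) by lia.
Qed.

Lemma kill_edge_layer d n (B : robp d n) k u v : k < n -> 0 < d ->
  layer d n k u -> (forall t, layer d n t (v t)) ->
  forall s i b, s < n - k -> layer d (n - k) s i ->
  layer d (n - k) s.+1 (kill_edge d n k u v (edge B) s i b).
Proof.
move=> lt_kn d_gt0 ku vP s i b lt_s.
rewrite (layer_shift d n k s.+1) // addnS /kill_edge.
case: posnP => [-> _|s_gt0].
  by rewrite addn0; apply: relabel_layer => //; apply: edge_layer.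
rewrite layer_shift // => ksi; case: eqP => [_|_].
  by rewrite /layer /=; case: eqP => _; rewrite ?eqxx ?orbT ?d_gt0 /=.
apply: relabel_layer => //; apply: edge_layer; first by lia.
by apply: relabel_layer => //; lia.
Qed.

Lemma relabel_kill_edge0 d n k u v e i b :
  relabel d n v k.+1 (kill_edge d n k u v e 0 i b) = e k u b.
Proof. by rewrite /kill_edge relabelK. Qed.

Lemma relabel_kill_edge d n k u v e s i b : 0 < s -> i != d ->
  relabel d n v (k + s).+1 (kill_edge d n k u v e s i b) =
    e (k + s) (relabel d n v (k + s) i) b.
Proof.
by move=> s_gt0 neq_id; rewrite /kill_edge (gtn_eqF s_gt0) (negPf neq_id) relabelK.
Qed.

(** * Comparison with the original program: soundness and loss *)

Lemma run_kill_dead d n k u v e s y : 0 < s ->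
  run (kill_edge d n k u v e) s d y = d.
Proof.
elim: y s => [|b y IH] s //= s_gt0.
by rewrite {2}/kill_edge (gtn_eqF s_gt0) eqxx IH.
Qed.

(** Since [d] is absorbing and differs from 1, an accepting run never meets it, and so mirrors a run
    of the original. *)
Lemma run_kill_sound_gt0 d n k u v e s i y : 1 < d -> 0 < s ->
  k + s + size y = n -> run (kill_edge d n k u v e) s i y == 1 ->
  run e (k + s) (relabel d n v (k + s) i) y == 1.
Proof.
move=> d_gt1; elim: y s i => [|b y IH] s i /= s_gt0.
  by rewrite addn0 /relabel => ->; rewrite ltnn.
move=> def_n; case: (eqVneq i d) => [->|neq_id].
  by rewrite {2}/kill_edge (gtn_eqF s_gt0) eqxx run_kill_dead // (gtn_eqF d_gt1).
move/IH; rewrite addnS relabel_kill_edge //.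
by apply=> //; rewrite -def_n addnS addSn.
Qed.

Lemma run_kill_sound d n k u v e y : 1 < d -> k < n -> k + size y = n ->
  run (kill_edge d n k u v e) 0 0 y == 1 -> run e k u y == 1.
Proof.
case: y => [|b y] d_gt1 lt_kn /= def_n; first by lia.
move/run_kill_sound_gt0; rewrite addn1 relabel_kill_edge0.
by apply=> //; rewrite -def_n addSnnS.
Qed.

Lemma accept_prob_ge0 e t r i : (0 <= accept_prob e t r i)%R.
Proof. by rewrite -expectation_run expectation_ge0. Qed.

(** The loss does not grow with [r]: averaging over two successors preserves an additive error [M].
    It is incurred only at [d], which stands for [v (k + s)]. *)
Lemma accept_prob_kill_gt0 d n k u v e (M : rat) s r i : (0 <= M)%R -> 0 < s ->
  (forall t, k < t < n -> (accept_prob e t (n - t) (v t) <= M)%R) ->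
  k + s + r = n ->
  (accept_prob e (k + s) r (relabel d n v (k + s) i) <=
   accept_prob (kill_edge d n k u v e) s r i + M)%R.
Proof.
move=> M_ge0 s_gt0 vM; elim: r s i s_gt0 => [|r IH] s i s_gt0.
  by rewrite addn0 /relabel => ->; rewrite ltnn /=; lra.
move=> def_n; case: (eqVneq i d) => [->|neq_id].
  have -> : relabel d n v (k + s) d = v (k + s).
    rewrite /relabel ifT /swap_nat ?eqxx; last by lia.
    by case: eqP.
  apply: (@le_trans _ _ M); last by rewrite lerDr accept_prob_ge0.
  have <- : n - (k + s) = r.+1 by lia.
  by apply: vM; lia.
have step b := IH s.+1 (kill_edge d n k u v e s i b) isT.
have def_n' : k + s.+1 + r = n by lia.
move: (step false def_n') (step true def_n').
by rewrite /= addnS !relabel_kill_edge // => le0 le1; lra.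
Qed.

Lemma accept_prob_kill d n k u v e (M : rat) : (0 <= M)%R -> k < n ->
  (forall t, k < t < n -> (accept_prob e t (n - t) (v t) <= M)%R) ->
  (accept_prob e k (n - k) u <=
   accept_prob (kill_edge d n k u v e) 0 (n - k) 0 + M)%R.
Proof.
move=> M_ge0 lt_kn vM; case def_r: (n - k) => [|r]; first by lia.
have def_n : k + 1 + r = n by lia.
have step b := @accept_prob_kill_gt0 d n k u v e M 1 r
  (kill_edge d n k u v e 0 0 b) M_ge0 isT vM def_n.
move: (step false) (step true).
by rewrite /= addn1 !relabel_kill_edge0 => le0 le1; lra.
Qed.

Lemma sqr_div_le (a : rat) n : 0 < n -> (0 <= a <= 1)%R ->
  (a ^+ 2 / (2 * n)%:R <= a / n%:R)%R.
Proof.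
move=> n_gt0 /andP[a_ge0 a_le1].
rewrite natrM invfM mulrA ler_pM2r ?invr_gt0 ?ltr0n // expr2.
by have := ler_piMl a_ge0 a_le1; lra.
Qed.

Theorem theorem6p5 (d n : nat) (d_gt0 : 0 < d) (n_gt0 : 0 < n)
    (f : n.-tuple bool -> bool) (f_comp : robp_computable d f) :
  exists (k : nat) (le_kn : k <= n) (g : (n - k).-tuple bool -> bool),
    [/\ sudden_death_robp_computable d g,
        [set zeros_cat le_kn y | y : (n - k).-tuple bool & g y]
          \subset [set x | f x]
      & (expectation f ^+ 2 / (2 * n)%:R <= expectation g)%R].
Proof.
case: f_comp => B Bf.
have fE : expectation f = accept_prob (edge B) 0 n 0.
  by rewrite -expectation_run; apply: eq_expectation => x; rewrite -Bf accepts_run.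
have f01 : (0 <= expectation f <= 1)%R.
  by rewrite expectation_ge0 expectation_le1.
set e := edge B in fE.
have f_run k (le_kn : k <= n) (y : (n - k).-tuple bool) :
    f (zeros_cat le_kn y) = (run e k (run e 0 0 (nseq k false)) y == 1).
  by rewrite -Bf accepts_run /zeros_cat val_tcast run_cat size_nseq.
have start_layer k : k <= n -> layer d n k (run e 0 0 (nseq k false)).
  by have := run_layer d n B 0 0 (nseq k false); rewrite size_nseq => L /L; apply.
pose v t := s2val (min_accept_vertex d n e t d_gt0).
have vP t : layer d n t (v t) by rewrite /v; case: min_accept_vertex.
have v_min t i : layer d n t i ->
    (accept_prob e t (n - t) (v t) <= accept_prob e t (n - t) i)%R.
  by rewrite /v; case: min_accept_vertex => /= w _ min_w; apply: min_w.
(* For d = 1 the label d accepts in the last layer, so nothing may be killed. *)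
have [le_d1|d_gt1] := leqP d 1.
  have d1 : d = 1 by lia.
  have eL t i b : t < n - 0 -> layer d (n - 0) t i ->
      layer d (n - 0) t.+1 (e t i b) by rewrite subn0; apply: edge_layer.
  (* With a single label in each layer after the start, every edge out of [d] already leads to [d],
     so the original program serves with [k = 0]. *)
  exists 0, (leq0n n), (accepts (@Robp d (n - 0) e eL)); split.
  - exists (@Robp d (n - 0) e eL) => // t b /andP[t_gt0 lt_tn] /=.
    have : layer d (n - 0) t.+1 (e t d b).
      by apply: eL => //; rewrite /layer gtn_eqF // d1; case: eqP.
    by rewrite d1 /layer /= orbb; case: eqP => _; [move/eqP|lia].
  - apply/subsetP => _ /imsetP[y Ky ->]; rewrite !inE in Ky *.
    by rewrite f_run; rewrite accepts_run in Ky.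
  - rewrite (eq_expectation _ _ _ (accepts_run _ _ _)) expectation_run /= subn0 -fE.
    apply: le_trans (sqr_div_le _ _ n_gt0 f01) _.
    by rewrite ler_piMr ?expectation_ge0 // invf_le1 ?ler1n ?ltr0n.
set c : rat := (expectation f / n%:R)%R.
have c_ge0 : (0 <= c)%R by rewrite divr_ge0 ?expectation_ge0.
have above0 : (n%:R * c <= accept_prob e 0 (n - 0) (v 0))%R.
  have /eqP-> : v 0 == 0 by have := vP 0; rewrite /layer.
  by rewrite subn0 -fE mulrC divfK // pnatr_eq0 -lt0n.
have [k lt_kn [above_k below]] :=
  last_above_line (fun t => accept_prob e t (n - t) (v t)) n c n_gt0 above0.
have le_kn := ltnW lt_kn.
(* The least probability in layer [k] bounds that of every vertex there, so the prefix needs no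
   careful choice. *)
pose u := run e 0 0 (nseq k false).
have ku : layer d n k u by apply: start_layer.
pose K := @Robp d (n - k) (kill_edge d n k u v e)
  (kill_edge_layer d n B k u v lt_kn d_gt0 ku vP).
exists k, le_kn, (accepts K); split.
- exists K => // t b /andP[t_gt0 _].
  by rewrite /= /kill_edge (gtn_eqF t_gt0) eqxx.
- apply/subsetP => _ /imsetP[y Ky ->]; rewrite !inE in Ky *.
  rewrite f_run; rewrite accepts_run in Ky.
  by apply: run_kill_sound Ky => //; rewrite size_tuple subnKC.
- apply: le_trans (sqr_div_le _ _ n_gt0 f01) _; rewrite -/c.
  rewrite (eq_expectation _ _ _ (accepts_run _ _ K)) expectation_run.
  (* [M] is the height of the line at layer [k + 1], its largest value after [k]. For [k = n - 1] it
     is zero and there is no layer to kill in. *)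
  set M : rat := ((n - k.+1)%:R * c)%R.
  have M_ge0 : (0 <= M)%R by rewrite mulr_ge0 ?ler0n.
  have le_M t : k < t < n -> (accept_prob e t (n - t) (v t) <= M)%R.
    move=> kt; apply: le_trans (ltW (below t kt)) _.
    by rewrite ler_wpM2r // ler_nat; lia.
  have := accept_prob_kill d n k u v e M M_ge0 lt_kn le_M.
  have := le_trans above_k (v_min k u ku).
  (* The drop [c] of the line from layer [k] to [k + 1] is what survives the loss [M]. *)
  have -> : ((n - k)%:R * c = c + M)%R.
    by rewrite /M subnS -[in LHS](@prednK (n - k)) ?subn_gt0 // mulrSr mulrDl mul1r addrC.
  by rewrite /K /=; lra.
Qed.
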